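(* Let $M=P+\epsilon D\in\mathbb{D}\mathbb{H}[t]$ be a bounded, monic motion polynomial and let $R$ be the greatest real polynomial factor of its primal part $P$. Then there exist a real polynomial $Q\in\mathbb{R}[t]$ with $\deg Q\le \deg R$ and linear rotation polynomials $t-h_1,\dots,t-h_n$ such that $QM=(t-h_1)\cdots(t-h_n)$. (In the paper this is stated as: the degree of the real polynomial $Q$ returned by the paper's factorization algorithm, which outputs $Q$ and such a factorization of $QM$, is at most $\deg R$.)
   Context: $\mathbb{H}$ denotes the real quaternions and $\mathbb{D}\mathbb{H}$ the dual quaternions $p+\epsilon q$ ($p,q\in\mathbb{H}$, $\epsilon^2=0$, $\epsilon$ commuting with $\mathbf{i},\mathbf{j},\mathbf{k}$), with conjugation $\overline{p+\epsilon q}=\overline{p}+\epsilon\overline{q}$ (quaternion conjugation negates the $\mathbf{i},\mathbf{j},\mathbf{k}$ coefficients). $\mathbb{D}\mathbb{H}[t]$ is the polynomial ring in $t$ over $\mathbb{D}\mathbb{H}$ with $t$ commuting with coefficients; $\overline{\sum c_it^i}=\sum\overline{c_i}t^i$. Write $M=P+\epsilon D$ with $P,D\in\mathbb{H}[t]$; $P$ is the primal part. $M$ is a motion polynomial if $P\overline{D}+D\overline{P}=0$ and its leading coefficient is invertible; monic if the leading coefficient is $1$; bounded if $P$ has no real zeros. The greatest real polynomial factor of $P\in\mathbb{H}[t]$ is the monic real polynomial of maximal degree dividing $P$ in $\mathbb{H}[t]$; it equals $\gcd(P,\overline{P})$ computed as the greatest real common factor. A linear rotation polynomial is $t-h$ with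 $h=p+\epsilon q$ ($p,q\in\mathbb{H}$) satisfying $q+\overline{q}=0$, $p\overline{q}+q\overline{p}=0$ and $p\notin\mathbb{R}$. *)

(* Defs.v *)
(* Quaternions and dual quaternions with coefficients in a
   commutative ring T, given by their real coordinates w.r.t. 1, i, j, k.
   With T = R (a realType) this is H (resp. DH); with T = {poly R} this is
   H[t] (resp. DH[t]), since t is central and commutes with i, j, k. *)
From HB Require Import structures.
From mathcomp Require Import all_boot all_order all_algebra.
From mathcomp Require Import reals.
Set Implicit Arguments. Unset Strict Implicit. Unset Printing Implicit Defensive.
Import Order.TTheory GRing.Theory Num.Theory.
Local Open Scope ring_scope.

Record quat (T : Type) := Quat { q0 : T; q1 : T; q2 : T; q3 : T }.
Arguments Quat {T}.

Section QuatOps.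
Variable T : comNzRingType.
Definition qzero : quat T := Quat 0 0 0 0.
Definition qone : quat T := Quat 1 0 0 0.
Definition qadd (a b : quat T) : quat T :=
  Quat (q0 a + q0 b) (q1 a + q1 b) (q2 a + q2 b) (q3 a + q3 b).
Definition qopp (a : quat T) : quat T := Quat (- q0 a) (- q1 a) (- q2 a) (- q3 a).
Definition qmul (a b : quat T) : quat T :=
  Quat (q0 a * q0 b - q1 a * q1 b - q2 a * q2 b - q3 a * q3 b)
       (q0 a * q1 b + q1 a * q0 b + q2 a * q3 b - q3 a * q2 b)
       (q0 a * q2 b - q1 a * q3 b + q2 a * q0 b + q3 a * q1 b)
       (q0 a * q3 b + q1 a * q2 b - q2 a * q1 b + q3 a * q0 b).
Definition qconj (a : quat T) : quat T := Quat (q0 a) (- q1 a) (- q2 a) (- q3 a).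
Definition qreal (r : T) : quat T := Quat r 0 0 0.
End QuatOps.

Record dq (T : Type) := DQ { prim : quat T; dual : quat T }.
Arguments DQ {T}.

Section DQOps.
Variable T : comNzRingType.
Definition dqone : dq T := DQ (qone T) (qzero T).
Definition dqmul (a b : dq T) : dq T :=
  DQ (qmul (prim a) (prim b))
     (qadd (qmul (prim a) (dual b)) (qmul (dual a) (prim b))).
End DQOps.

Section Polys.
Variable R : realType.

Definition qmap (A B : Type) (f : A -> B) (a : quat A) : quat B :=
  Quat (f (q0 a)) (f (q1 a)) (f (q2 a)) (f (q3 a)).

Definition qeval (P : quat {poly R}) (x : R) : quat R := qmap (fun p => p.[x]) P.

Definition dqcoef (M : dq {poly R}) (i : nat) : dq R :=
  DQ (qmap (fun p : {poly R} => p`_i) (prim M)) (qmap (fun p : {poly R} => p`_i) (dual M)).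

Definition qsize (P : quat {poly R}) : nat :=
  maxn (maxn (size (q0 P)) (size (q1 P))) (maxn (size (q2 P)) (size (q3 P))).
Definition dqsize (M : dq {poly R}) : nat := maxn (qsize (prim M)) (qsize (dual M)).

Definition dq_lead_coef (M : dq {poly R}) : dq R := dqcoef M (dqsize M).-1.

(* a dual quaternion p + eps q is invertible iff p <> 0 *)
Definition dq_invertible (h : dq R) : Prop :=
  exists g : dq R, dqmul h g = dqone R /\ dqmul g h = dqone R.

Definition motion_poly (M : dq {poly R}) : Prop :=
  qadd (qmul (prim M) (qconj (dual M))) (qmul (dual M) (qconj (prim M)))
    = qzero {poly R}
  /\ dq_invertible (dq_lead_coef M).

Definition dq_monic (M : dq {poly R}) : Prop := dq_lead_coef M = dqone R.

Definition bounded (M : dq {poly R}) : Prop :=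
  forall x : R, qeval (prim M) x <> qzero R.

Definition real_divides (r : {poly R}) (P : quat {poly R}) : Prop :=
  exists X : quat {poly R}, P = qmul (qreal r) X.

Definition greatest_real_factor (G : {poly R}) (P : quat {poly R}) : Prop :=
  G \is monic /\ real_divides G P /\
  forall S : {poly R}, S \is monic -> real_divides S P -> (size S <= size G)%N.

Definition lin_poly (h : dq R) : dq {poly R} :=
  DQ (Quat ('X - (q0 (prim h))%:P) (- (q1 (prim h))%:P)
           (- (q2 (prim h))%:P) (- (q3 (prim h))%:P))
     (Quat (- (q0 (dual h))%:P) (- (q1 (dual h))%:P)
           (- (q2 (dual h))%:P) (- (q3 (dual h))%:P)).

Definition rotation_h (h : dq R) : Prop :=
  qadd (dual h) (qconj (dual h)) = qzero R /\
  qadd (qmul (prim h) (qconj (dual h))) (qmul (dual h) (qconj (prim h)))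
    = qzero R /\
  ~ (q1 (prim h) = 0 /\ q2 (prim h) = 0 /\ q3 (prim h) = 0).

Definition dqscale (Q : {poly R}) (M : dq {poly R}) : dq {poly R} :=
  DQ (qmul (qreal Q) (prim M)) (qmul (qreal Q) (dual M)).

Definition dqprod (hs : seq (dq R)) : dq {poly R} :=
  foldr (fun h acc => dqmul (lin_poly h) acc) (dqone {poly R}) hs.
Fixpoint all_rotation (hs : seq (dq R)) : Prop :=
  if hs is h :: hs' then rotation_h h /\ all_rotation hs' else True.
End Polys.

(* Main.v *)
(* The quaternion norm of P is a real polynomial without real zeros, so it has a
   factor N = (t-a)^2 + b^2 with b <> 0.  If N does not divide P, or if N
   divides both P and the norm of D, then M = M'(t-h) with t-h a rotation
   polynomial of norm N, and one recurses on M'.  In the remaining case N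
   divides P but not the norm of D.  For every quaternion p with
   (t-p)(t-p^bar) = N there is then p' of the same norm polynomial with
   (t-p)M = X(t-p'), hence N M = (t-p^bar) X (t-p').  The degree of X is that
   of M, and for a suitable p on the sphere of roots of N the greatest real
   factor of its primal part has dropped by deg N = 2: multiplying by N is paid
   for by that drop. *)
From HB Require Import structures.
Require Import Defs.
From mathcomp Require Import all_boot all_order all_algebra ring lra zify.
From mathcomp Require Import reals complex.
Set Implicit Arguments.
Unset Strict Implicit.
Unset Printing Implicit Defensive.
Import Order.TTheory GRing.Theory Num.Theory.
Local Open Scope ring_scope.

(** * The ring of quaternions over a commutative ring, its norm and inner product *)

Lemma quat_ext (T : Type) (a b : quat T) :
  q0 a = q0 b -> q1 a = q1 b -> q2 a = q2 b -> q3 a = q3 b -> a = b.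
Proof. by case: a b => ? ? ? ? [? ? ? ?] /= -> -> -> ->. Qed.

Definition quat_tuple (T : Type) (a : quat T) := (q0 a, q1 a, q2 a, q3 a).
Definition tuple_quat (T : Type) (u : T * T * T * T) :=
  Quat u.1.1.1 u.1.1.2 u.1.2 u.2.
Lemma quat_tupleK (T : Type) : cancel (@quat_tuple T) (@tuple_quat T).
Proof. by case. Qed.

HB.instance Definition _ (T : choiceType) :=
  Choice.copy (quat T) (can_type (@quat_tupleK T)).

Ltac quat_ring := repeat intro; apply: quat_ext => /=; ring.

Section QuatRing.
Variable T : comNzRingType.

Fact qaddA : associative (@qadd T). Proof. quat_ring. Qed.
Fact qaddC : commutative (@qadd T). Proof. quat_ring. Qed.
Fact qadd0 : left_id (qzero T) (@qadd T). Proof. quat_ring. Qed.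
Fact qaddN : left_inverse (qzero T) (@qopp T) (@qadd T). Proof. quat_ring. Qed.
Fact qmulA : associative (@qmul T). Proof. quat_ring. Qed.
Fact qmul1q : left_id (qone T) (@qmul T). Proof. quat_ring. Qed.
Fact qmulq1 : right_id (qone T) (@qmul T). Proof. quat_ring. Qed.
Fact qmulDl : left_distributive (@qmul T) (@qadd T). Proof. quat_ring. Qed.
Fact qmulDr : right_distributive (@qmul T) (@qadd T). Proof. quat_ring. Qed.
Fact qone_neq0 : qone T != qzero T.
Proof. by apply/eqP => -[] /eqP; rewrite oner_eq0. Qed.

HB.instance Definition _ :=
  GRing.isZmodule.Build (quat T) qaddA qaddC qadd0 qaddN.
HB.instance Definition _ :=
  GRing.Zmodule_isNzRing.Build (quat T)
    qmulA qmul1q qmulq1 qmulDl qmulDr qone_neq0.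

Implicit Types (a b : quat T) (r s : T).

Lemma qmulE a b : qmul a b = a * b. Proof. by []. Qed.

Definition nrm a := q0 a ^+ 2 + q1 a ^+ 2 + q2 a ^+ 2 + q3 a ^+ 2.
Definition qdot a b := q0 a * q0 b + q1 a * q1 b + q2 a * q2 b + q3 a * q3 b.

Lemma qconjM a b : qconj (a * b) = qconj b * qconj a. Proof. quat_ring. Qed.
Lemma qmul_conj a : a * qconj a = qreal (nrm a).
Proof. by apply: quat_ext; rewrite /nrm /=; ring. Qed.
Lemma qconj_mul a : qconj a * a = qreal (nrm a).
Proof. by apply: quat_ext; rewrite /nrm /=; ring. Qed.
Lemma qrealC r a : qreal r * a = a * qreal r. Proof. quat_ring. Qed.
Lemma qrealM r s : qreal (r * s) = qreal r * qreal s. Proof. quat_ring. Qed.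
Lemma nrmM a b : nrm (a * b) = nrm a * nrm b.
Proof. by rewrite /nrm /=; ring. Qed.
Lemma nrm_conj a : nrm (qconj a) = nrm a.
Proof. by rewrite /nrm /=; ring. Qed.
(** A dual quaternion a + eps c has norm [nrm a] + 2 eps [qdot a c]; this is the dual part of the
    multiplicativity of that norm. *)
Lemma qdotM a b c d :
  qdot (a * b) (a * d + c * b) = nrm a * qdot b d + qdot a c * nrm b.
Proof. by rewrite /qdot /nrm /=; ring. Qed.
End QuatRing.

(** * Real polynomial factors of quaternion polynomials *)

Section RealDivision.
Variable R : realType.
Implicit Types (N S : {poly R}) (A B : quat {poly R}).

(** For nonzero A, the greatest real factor up to a nonzero constant: [gcdp] is not normalised. *)
Definition content A := gcdp (gcdp (q0 A) (q1 A)) (gcdp (q2 A) (q3 A)).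

Lemma real_dividesE N A : real_divides N A <-> N %| content A.
Proof.
rewrite !dvdp_gcd; split=> [[X ->]|].
  rewrite /= !mul0r !subr0 !addr0.
  by rewrite !dvdp_mulr ?dvdpp.
case/andP=> /andP[/dvdpP[x0 e0] /dvdpP[x1 e1]].
case/andP=> /dvdpP[x2 e2] /dvdpP[x3 e3].
exists (Quat x0 x1 x2 x3).
by apply: quat_ext; rewrite /= ?e0 ?e1 ?e2 ?e3; ring.
Qed.

Lemma real_dividesMl N A B : real_divides N B -> real_divides N (A * B).
Proof.
by case=> X ->; exists (A * X); rewrite !qmulE mulrA -qrealC -mulrA.
Qed.

Lemma real_dividesMr N A B : real_divides N A -> real_divides N (A * B).
Proof. by case=> X ->; exists (X * B); rewrite !qmulE -mulrA. Qed.

Lemma content_eq0 A : content A = 0 -> A = 0.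
Proof.
move/eqP; rewrite !gcdp_eq0.
case/andP=> /andP[/eqP e0 /eqP e1] /andP[/eqP e2 /eqP e3]; exact: quat_ext.
Qed.

Lemma contentM N A : content (qreal N * A) %= N * content A.
Proof.
have e : forall x y, gcdp (N * x) (N * y) %= N * gcdp x y.
  by move=> x y; rewrite eqp_sym; apply: mulp_gcdr.
rewrite /content /= !mul0r !subr0 !addr0.
apply: eqp_trans (e _ _).
by apply: eqp_gcd; rewrite ?e.
Qed.

Lemma multiplicity (N c : {poly R}) : c != 0 -> (1 < size N)%N ->
  exists m c', c = N ^+ m * c' /\ ~~ (N %| c').
Proof.
move=> c0 sN; have [n] := ubnP (size c); elim: n c c0 => // n IH c c0 sc.
have [/dvdpP[d e]|nd] := boolP (N %| c); last by exists 0%N, c; rewrite mul1r.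
have d0 : d != 0 by apply: contra_neq c0 => d0; rewrite e d0 mul0r.
have N0 : N != 0 by rewrite -size_poly_gt0 ltnW.
have [|m [c' [ed nc']]] := IH d d0.
  move: sc; rewrite e size_mul //; case: (size N) sN => // -[//|k] _.
  by rewrite !addnS ltnS; apply: leq_ltn_trans; rewrite leq_addr.
by exists m.+1, c'; split; rewrite // e ed exprS; ring.
Qed.

Lemma real_multiplicity N A : A != 0 -> (1 < size N)%N ->
  exists m A', A = qreal (N ^+ m) * A' /\ ~ real_divides N A'.
Proof.
move=> A0 sN.
have c0 : content A != 0 by apply: contra_neq A0; apply: content_eq0.
have [m [c' [e nc']]] := multiplicity c0 sN.
have [A' eA] : real_divides (N ^+ m) A.
  by apply/real_dividesE; rewrite e dvdp_mulr.
exists m, A'; split=> // -[B eB]; case/negP: nc'.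
have N0 : N != 0 by rewrite -size_poly_gt0 ltnW.
rewrite -(@dvdp_mul2l _ (N ^+ m)) ?expf_neq0 // -e.
by apply/real_dividesE; rewrite eA eB; exists B; rewrite !qmulE mulrA qrealM.
Qed.
End RealDivision.

(** * Irreducible real quadratics and linear right factors in H[t] *)

Section Quadratic.
Variable R : realType.
Implicit Types (A B : quat {poly R}) (a b c : R) (p r : quat R).

Definition quad a b : {poly R} := ('X - a%:P) ^+ 2 + (b ^+ 2)%:P.

Lemma size_quad a b : size (quad a b) = 3%N.
Proof.
rewrite /quad size_polyDl size_exp_XsubC //.
exact: leq_ltn_trans (size_polyC_leq1 _) _.
Qed.

Lemma quad_neq0 a b : quad a b != 0.
Proof. by rewrite -size_poly_gt0 size_quad. Qed.

Lemma quad_gt0 a b x : b != 0 -> 0 < (quad a b).[x].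
Proof.
move=> b0; have b2 : 0 < b ^+ 2 by rewrite exprn_even_gt0.
by rewrite /quad !hornerE ltr_wpDl ?sqr_ge0.
Qed.

Lemma quad_irreducible a b : b != 0 -> irreducible_poly (quad a b).
Proof.
move=> b0; apply: cubic_irreducible; rewrite ?size_quad // => x.
by rewrite rootE gt_eqF // quad_gt0.
Qed.

Lemma quad_dvd_linear a b c1 c0 :
  quad a b %| c1%:P * 'X + c0%:P -> c1 = 0 /\ c0 = 0.
Proof.
move=> d; have e : c1%:P * 'X + c0%:P = 0 :> {poly R}.
  apply/eqP; apply: contraTT d => ne; apply/negP => /(dvdp_leq ne).
  rewrite size_quad size_MXaddC; case: ifP => // _.
  by rewrite ltnS => /leq_trans/(_ (size_polyC_leq1 c1)).
have coefs i := congr1 (fun q : {poly R} => q`_i) e.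
by split; [have := coefs 1%N | have := coefs 0%N];
  rewrite coefD coefMX !coefC /= ?addr0 ?add0r.
Qed.

Lemma size2_poly (q : {poly R}) :
  (size q <= 2)%N -> q = (q`_1)%:P * 'X + (q`_0)%:P.
Proof.
move=> s; apply/polyP => -[|[|i]].
all: rewrite coefD coefMX !coefC /= ?addr0 ?add0r //.
by rewrite nth_default // (leq_trans s).
Qed.

(** A complex root a + b i of q has b <> 0 because q has no real zero. The remainder c1 t + c0 of q
    modulo [quad a b] vanishes there too; its imaginary part c1 b gives c1 = 0, and then c0 = 0. *)
Lemma quad_factor (q : {poly R}) : (forall x, q.[x] != 0) -> (1 < size q)%N ->
  exists a b, b != 0 /\ quad a b %| q.
Proof.
move=> nz sq; pose f := real_complex R.
have /closed_rootP[[a b] rz] : size (map_poly f q) != 1%N.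
  by rewrite size_map_poly; case: (size q) sq => [|[]].
have b0 : b != 0.
  apply/eqP=> eb; move: rz; rewrite eb -[Complex a 0]/(f a) fmorph_root rootE.
  by apply/negP.
exists a, b; split=> //; rewrite /dvdp.
have : (size (q %% quad a b)%R <= 2)%N.
  by rewrite -ltnS -(size_quad a b) ltn_modp quad_neq0.
move/size2_poly; move: ((q %% _)`_1) ((q %% _)`_0) => c1 c0 em; rewrite em.
move: rz; rewrite [in map_poly f q](divp_eq q (quad a b)) rootE.
rewrite rmorphD rmorphM /= hornerD hornerM.
have -> : (map_poly f (quad a b)).[Complex a b] = 0.
  rewrite /quad rmorphD rmorphXn rmorphB /= map_polyX !map_polyC /= !hornerE.
  by apply/eqP; rewrite eq_complex /=; apply/andP; split; apply/eqP; ring.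
rewrite mulr0 add0r em rmorphD rmorphM /= map_polyX !map_polyC /= !hornerE.
rewrite eq_complex /= => /andP[/eqP h1 /eqP h2].
have c10 : c1 = 0 by apply: (mulIf b0); lra.
have c00 : c0 = 0 by move: h1; rewrite c10; lra.
by rewrite c10 c00 polyC0 mul0r addr0.
Qed.

Definition qC (r : quat R) : quat {poly R} := qmap (@polyC R) r.
Definition qlin p : quat {poly R} := qreal 'X - qC p.

Lemma qCM p r : qC (p * r) = qC p * qC r. Proof. quat_ring. Qed.
Lemma qCD p r : qC (p + r) = qC p + qC r. Proof. quat_ring. Qed.
Lemma qCN p : qC (- p) = - qC p. Proof. quat_ring. Qed.
Lemma qC0 : qC 0 = 0. Proof. quat_ring. Qed.
Lemma qlin_conj p : qconj (qlin p) = qlin (qconj p). Proof. quat_ring. Qed.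
Lemma nrm_qC p : nrm (qC p) = (nrm p)%:P. Proof. rewrite /nrm /=; ring. Qed.

Lemma nrm_eq0 r : nrm r = 0 -> r = 0.
Proof.
case: r => x0 x1 x2 x3; rewrite /nrm /= => e.
have h0 := sqr_ge0 x0; have h1 := sqr_ge0 x1.
have h2 := sqr_ge0 x2; have h3 := sqr_ge0 x3.
have s0 : x0 ^+ 2 == 0 by apply/eqP; lra.
have s1 : x1 ^+ 2 == 0 by apply/eqP; lra.
have s2 : x2 ^+ 2 == 0 by apply/eqP; lra.
have s3 : x3 ^+ 2 == 0 by apply/eqP; lra.
by move: s0 s1 s2 s3; rewrite !sqrf_eq0 => /eqP-> /eqP-> /eqP-> /eqP->.
Qed.

Lemma qmul_solve r p : nrm r != 0 -> exists q, r * q = p.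
Proof.
move=> nr; exists (qreal (nrm r)^-1 * qconj r * p).
rewrite !mulrA -qrealC -(mulrA (qreal _)) qmul_conj -qrealM mulVf //.
by rewrite -[qreal 1]/(1 : quat R) mul1r.
Qed.

Lemma qdot_qlin p r : qdot (qlin p) (qC r) = (q0 r)%:P * 'X - (qdot p r)%:P.
Proof. by rewrite /qdot /=; ring. Qed.

Lemma quad_division A a b : exists T r1 r0,
  A = qreal (quad a b) * T + (qC r1 * qreal 'X + qC r0).
Proof.
pose N := quad a b.
pose rem i : quat R := qmap (fun x : {poly R} => (x %% N)`_i) A.
exists (qmap (fun x => x %/ N) A), (rem 1%N), (rem 0%N).
have e x : x = N * (x %/ N) + (((x %% N)`_1)%:P * 'X + ((x %% N)`_0)%:P).
  rewrite -size2_poly; first by rewrite mulrC -divp_eq.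
  by rewrite -ltnS -(size_quad a b) ltn_modp quad_neq0.
by apply: quat_ext; rewrite [LHS]e /= -/N; ring.
Qed.

(** Modulo N the norm of A is that of the remainder r1 t + r0, which has degree at most 2 and so
    must equal [nrm r1] N. If r1 were 0, so would be r0, and N would divide A. Hence r1 is
    invertible and r1 t + r0 = r1 (t - p) with p = - r1^-1 r0. *)
Lemma right_factor_remainder A a b : let N := quad a b in
  N %| nrm A -> ~ real_divides N A ->
  exists p r T, [/\ nrm (qlin p) = N, nrm r != 0
                   & A = qreal N * T + qC r * qlin p].
Proof.
move=> N dN nd; have [T [r1 [r0 eA]]] := quad_division A a b.
(* [c1] t + [c0] is the norm of r1 t + r0 minus [nrm r1] N. *)
pose c1 := qdot r1 r0 *+ 2 + a * nrm r1 *+ 2.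
pose c0 := nrm r0 - nrm r1 * (a ^+ 2 + b ^+ 2).
have /quad_dvd_linear[e1 e0] : N %| c1%:P * 'X + c0%:P.
  have -> : c1%:P * 'X + c0%:P = nrm A -
      N * (N * nrm T + qdot T (qC r1 * qreal 'X + qC r0) *+ 2 + (nrm r1)%:P).
    by rewrite eA /N /quad /c1 /c0 /nrm /qdot /=; ring.
  by rewrite dvdp_sub // dvdp_mulr.
have n1 : nrm r1 != 0.
  apply/eqP=> n1; apply: nd; move: e0.
  rewrite /c0 n1 mul0r subr0 => /nrm_eq0 r00.
  rewrite eA r00 (nrm_eq0 n1) /=.
  by exists T; rewrite qC0 mul0r !addr0.
have [p rp] := qmul_solve (- r0) n1.
have er : qC r1 * qlin p = qC r1 * qreal 'X + qC r0.
  by rewrite mulrBr -qCM rp qCN opprK.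
exists p, r1, T; split=> //; last by rewrite er.
apply: (@mulfI _ (nrm r1)%:P); first by rewrite polyC_eq0.
rewrite -nrm_qC -nrmM er.
transitivity ((nrm r1)%:P * N + (c1%:P * 'X + c0%:P)).
  by rewrite /N /quad /c1 /c0 /nrm /qdot /=; ring.
by rewrite e1 e0 nrm_qC; ring.
Qed.

(** N = (t - p^bar)(t - p) is central, so t - p is a right factor of both summands N T and r (t -
    p). *)
Lemma right_factor_primitive A a b :
  quad a b %| nrm A -> ~ real_divides (quad a b) A ->
  exists p A', nrm (qlin p) = quad a b /\ A = A' * qlin p.
Proof.
move=> dA nA; have [p [r [T [np _ ->]]]] := right_factor_remainder dA nA.
exists p, (T * qconj (qlin p) + qC r); split=> //.
by rewrite mulrDl -mulrA qconj_mul np qrealC.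
Qed.

Lemma qlin_nonreal a b p : b != 0 -> nrm (qlin p) = quad a b ->
  ~ [/\ q1 p = 0, q2 p = 0 & q3 p = 0].
Proof.
move=> b0 np [e1 e2 e3]; have := quad_gt0 a (q0 p) b0.
by rewrite -np /nrm /= e1 e2 e3 !hornerE subrr expr0n oppr0 expr0n !addr0 ltxx.
Qed.
End Quadratic.

(** * Splitting off a rotation factor, and trading a real quadratic *)

Section MotionPolynomials.
Variable R : realType.
Implicit Types (A B V : quat {poly R}) (a b c : R) (p q r : quat R).
Implicit Types (M X : dq {poly R}) (h : dq R).

Lemma nrm_qlin_quad (a b x y z : R) : b ^+ 2 = x ^+ 2 + y ^+ 2 + z ^+ 2 ->
  nrm (qlin (Quat a x y z)) = quad a b.
Proof. by move=> e; rewrite /nrm /quad e /=; ring. Qed.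

(** When N divides A, every p with [nrm (qlin p)] = N gives a right factor; a + b i is taken. *)
Lemma right_factor A a b : quad a b %| nrm A ->
  exists p A', nrm (qlin p) = quad a b /\ A = A' * qlin p.
Proof.
have [/real_dividesE[A1 ->] _|] := boolP (quad a b %| content A); last first.
  by move=> /negP nd dA; apply: right_factor_primitive dA _ => /real_dividesE.
have np : nrm (qlin (Quat a b 0 0)) = quad a b by apply: nrm_qlin_quad; ring.
exists (Quat a b 0 0), (A1 * qconj (qlin (Quat a b 0 0))); split=> //.
by rewrite -mulrA qconj_mul np qmulE qrealC.
Qed.

(* V is tested against the conjugate pairs a +- b i and a +- b j: adding the two
   products of a pair leaves, modulo N, a nonzero multiple of the component of V
   orthogonal to the axis, and two axes together see all of V. *)
Lemma sphere_point V a b : b != 0 -> q0 V = 0 -> ~ real_divides (quad a b) V ->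
  exists p, nrm (qlin p) = quad a b /\
    ~ real_divides (quad a b) (qlin p * V * qconj (qlin p)).
Proof.
move=> b0 V0 nV; set N := quad a b in nV *.
pose test p := N %| content (qlin p * V * qconj (qlin p)).
suff [p [np tp]] : exists p, nrm (qlin p) = N /\ ~~ test p.
  by exists p; split=> // /real_dividesE; apply/negP.
have tryp p : nrm (qlin p) = N ->
    (exists p, nrm (qlin p) = N /\ ~~ test p) \/ test p.
  by move=> np; have [|t] := boolP (test p); [right | left; exists p].
have cst v : N %| (4 * b ^+ 2)%:P * v -> N %| v.
  by rewrite mul_polyC dvdpZr // mulf_neq0 ?expf_neq0 // pnatr_eq0.
have /tryp[//|t1] : nrm (qlin (Quat a b 0 0)) = N.
  by apply: nrm_qlin_quad; ring.
have /tryp[//|t2] : nrm (qlin (Quat a (- b) 0 0)) = N.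
  by apply: nrm_qlin_quad; ring.
have /tryp[//|t3] : nrm (qlin (Quat a 0 b 0)) = N.
  by apply: nrm_qlin_quad; ring.
have /tryp[//|t4] : nrm (qlin (Quat a 0 (- b) 0)) = N.
  by apply: nrm_qlin_quad; ring.
case: nV; apply/real_dividesE; move: t4 t3 t2 t1.
rewrite /test !dvdp_gcd.
move=> /andP[/andP[_ j1] _] /andP[/andP[_ j2] _].
move=> /andP[_ /andP[i2 i3]] /andP[_ /andP[i2' i3']].
rewrite V0 dvdp0 /=; apply/and3P; split; apply: cst.
- have := dvdp_sub (dvdp_mull (2 * q1 V) (dvdpp N)) (dvdp_add j1 j2).
  by congr (_ %| _); rewrite /N /quad /= V0; ring.
- have := dvdp_sub (dvdp_mull (2 * q2 V) (dvdpp N)) (dvdp_add i2 i2').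
  by congr (_ %| _); rewrite /N /quad /= V0; ring.
- have := dvdp_sub (dvdp_mull (2 * q3 V) (dvdpp N)) (dvdp_add i3 i3').
  by congr (_ %| _); rewrite /N /quad /= V0; ring.
Qed.

Lemma lin_polyE h : lin_poly h = DQ (qlin (prim h)) (- qC (dual h)).
Proof. by case: h => p q; congr DQ; apply: quat_ext => /=; ring. Qed.

Lemma dqmulE M X :
  dqmul M X = DQ (prim M * prim X) (prim M * dual X + dual M * prim X).
Proof. by []. Qed.

Lemma rotationP p q : q0 q = 0 -> qdot p q = 0 ->
  ~ [/\ q1 p = 0, q2 p = 0 & q3 p = 0] -> rotation_h (DQ p q).
Proof.
move=> q00 pq np; split; first by apply: quat_ext; rewrite /= ?q00; ring.
split; last by move=> [e1 [e2 e3]]; apply: np.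
have -> : qzero R = qreal (qdot p q *+ 2) by rewrite pq mul0rn.
by apply: quat_ext; rewrite /qdot /=; ring.
Qed.

Lemma qdot_conj (T : comNzRingType) (a b : quat T) :
  qconj a * b + qconj b * a = qreal (qdot a b *+ 2).
Proof. by apply: quat_ext; rewrite /qdot /=; ring. Qed.

(** The inner product of primal and dual part after division by n: once [nrm l] = n, only the last
    term is not visibly a multiple of n. *)
Lemma qdot_expand (T : comNzRingType) n (t r l s v q : quat T) :
  qdot (qreal n * t + r * l) (qreal n * s + (v * l - r * q)) =
  n * (n * qdot t s + qdot t (v * l - r * q) + qdot (r * l) s)
  + qdot r v * nrm l - nrm r * qdot l q.
Proof. by rewrite /qdot /nrm /=; ring. Qed.

(** The right factor t - p of P extends to t - (p + eps q). Modulo N, orthogonality of P and D says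
    that N divides [nrm r] times [qdot (qlin p) (qC q)]. This is linear in t, hence zero, and its
    two coefficients are the rotation conditions on q. *)
Lemma dual_right_factor M a b : b != 0 -> qdot (prim M) (dual M) = 0 ->
  quad a b %| nrm (prim M) -> ~ real_divides (quad a b) (prim M) ->
  exists h M', rotation_h h /\ M = dqmul M' (lin_poly h).
Proof.
case: M => P D /= b0 PD dP nP.
have [p [r [T [np nr eP]]]] := right_factor_remainder dP nP.
have [S [s1 [s0 eD]]] := quad_division D a b.
(* q is chosen so that M = (r + eps s1)(t - (p + eps q)) modulo N. *)
have [q rq] := qmul_solve (- (s0 + s1 * p)) nr.
have eD' : D = qreal (quad a b) * S + (qC s1 * qlin p - qC r * qC q).
  by rewrite eD -qCM rq qCN opprK mulrBr -qCM qCD addrACA addNr addr0.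
have : quad a b %| (nrm r)%:P * qdot (qlin p) (qC q).
  have := qdot_expand (quad a b) T (qC r) (qlin p) S (qC s1) (qC q).
  rewrite -eP -eD' PD np nrm_qC => /esym/eqP; rewrite subr_eq0 => /eqP <-.
  by rewrite mulrC -mulrDl dvdp_mull.
rewrite mul_polyC dvdpZr // qdot_qlin -polyCN => /quad_dvd_linear[q00].
move/eqP; rewrite oppr_eq0 => /eqP pq.
exists (DQ p q), (DQ (T * qconj (qlin p) + qC r)
                     (S * qconj (qlin p) + qC s1 + T * qC q)).
split; first by apply: rotationP => //; apply: qlin_nonreal np.
(* As q is vectorial and orthogonal to p, moving it past t - p conjugates that factor; the terms
   containing T q then cancel in the product. *)
have sw : qconj (qlin p) * qC q = qC q * qlin p.
  have e1 : qconj (qC q) = - qC q.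
    by apply: quat_ext; rewrite /= ?q00 ?polyC0; ring.
  have e2 : qdot (qlin p) (qC q) = 0.
    by rewrite qdot_qlin q00 pq polyC0 mul0r subr0.
  apply/eqP; rewrite -subr_eq0 -mulNr -e1 qdot_conj e2 mul0rn.
  by apply/eqP.
rewrite lin_polyE dqmulE /=; congr DQ.
  by rewrite eP mulrDl -mulrA qconj_mul np qrealC.
rewrite eD' !mulrDl -!mulrA qconj_mul np -qrealC.
rewrite !mulrN sw.
by rewrite [RHS]addrC !addrA addrK.
Qed.

(** The norm of D yields a right factor t - p of D, and P = P1 (t - p^bar)(t - p) shares it,
    whatever p on the sphere is. *)
Lemma primal_right_factor M a b :
  quad a b %| nrm (dual M) -> real_divides (quad a b) (prim M) ->
  exists p M', nrm (qlin p) = quad a b /\ M = dqmul M' (lin_poly (DQ p 0)).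
Proof.
case: M => P D /= dD [P1 eP].
have [p [D' [np eD]]] := right_factor dD.
exists p, (DQ (P1 * qconj (qlin p)) D'); split=> //.
rewrite lin_polyE dqmulE /= qC0 oppr0 mulr0 add0r -eD -mulrA qconj_mul np.
by rewrite eP qmulE qrealC.
Qed.

(** Write P = N^(m+1) P2 with N not dividing P2, and L = t - p. N divides the norm of L D, so L D =
    A' L' with L' = t - p', while L P = N^m (L P2 L'^bar) L'. The content drops if N does not divide
    Y = L P2 L'^bar, and p is chosen for that. *)
Lemma swap_factor M a b : b != 0 -> prim M != 0 -> qdot (prim M) (dual M) = 0 ->
  real_divides (quad a b) (prim M) -> ~~ (quad a b %| nrm (dual M)) ->
  exists p p' X, [/\ nrm (qlin p) = quad a b, nrm (qlin p') = quad a b,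
    dqmul (lin_poly (DQ p 0)) M = dqmul X (lin_poly (DQ p' 0))
    & content (prim X) * quad a b %| content (prim M)].
Proof.
case: M => P D /= b0 P0 PD dP nD; set N := quad a b in dP nD *.
have N0 : N != 0 := quad_neq0 a b.
have copN (x : {poly R}) : coprimep N x = ~~ (N %| x).
  by apply: irreducible_poly_coprime; apply: quad_irreducible.
have sN : (1 < size N)%N by rewrite size_quad.
have [m [P2 [eP nP2]]] := real_multiplicity P0 sN.
case: m eP => [|m] eP.
  by case: nP2; rewrite eP expr0 mul1r in dP.
(* The motion condition, divided by N^(m+1), makes V purely vectorial. *)
pose V := P2 * qconj D.
have P2D : qdot P2 D = 0.
  apply: (mulfI (expf_neq0 m.+1 N0)); rewrite mulr0 -PD eP /qdot /=; ring.
have V0 : q0 V = 0 by rewrite -P2D /V /qdot /=; ring.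
(* Otherwise N divides P2 D^bar D = [nrm D] P2, although it is prime to [nrm D] and does not divide
   P2. *)
have nV : ~ real_divides N V.
  move=> dV; apply: nP2; apply/real_dividesE.
  have : real_divides N (qreal (nrm D) * P2).
    by rewrite qrealC -qconj_mul mulrA; apply: real_dividesMr.
  move/real_dividesE; rewrite (eqp_dvdr _ (contentM _ _)) Gauss_dvdpr //.
  by rewrite copN.
have [p [np nLVL]] := sphere_point b0 V0 nV.
pose L := qlin p.
have dA : N %| nrm (L * D) by rewrite nrmM np dvdp_mulr.
have [p' [A' [np' eA]]] := right_factor dA.
pose L' := qlin p'; pose Y := L * P2 * qconj L'.
(* From L D = A' L' follows Y A'^bar = L P2 D^bar L^bar, which N does not divide by the choice of
   p. *)
have nY : ~ real_divides N Y.
  move=> dY; apply: nLVL.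
  have -> : L * V * qconj L = Y * qconj A'.
    by rewrite /V /Y -!mulrA -!qconjM eA.
  exact: real_dividesMr.
pose X := DQ (qreal (N ^+ m) * Y) A'.
exists p, p', X; split=> //.
  rewrite !lin_polyE !dqmulE /= !qC0 !oppr0 mul0r mulr0 addr0 add0r -eA.
  congr DQ; rewrite -[qlin p]/L /Y -[qlin p']/L' -!mulrA qconj_mul np'.
  rewrite eP exprSr qrealM -!mulrA.
  by rewrite (qrealC N P2) mulrA -(qrealC _ L) -mulrA.
(* L^bar Y L' = N^2 P2, so [content Y] divides N^2 [content P2], and N^2 drops out by
   coprimality. *)
have dY : content Y %| content P2.
  have : real_divides (content Y) (qreal (N * N) * P2).
    have -> : qreal (N * N) * P2 = qconj L * Y * L'.
      rewrite /Y -!mulrA qconj_mul np' !mulrA qconj_mul np qrealM -!mulrA.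
      by rewrite (qrealC N P2).
    by apply: real_dividesMr; apply: real_dividesMl; apply/real_dividesE.
  have cop : coprimep N (content Y).
    by rewrite copN; apply/negP=> /real_dividesE.
  move/real_dividesE; rewrite (eqp_dvdr _ (contentM _ _)) Gauss_dvdpr //.
  by rewrite coprimepMr coprimep_sym cop.
rewrite /X /= (eqp_dvdl _ (eqp_mulr N (contentM _ _))) eP.
rewrite (eqp_dvdr _ (contentM _ _)).
by rewrite exprSr mulrAC dvdp_mul2l // mulf_neq0 ?expf_neq0.
Qed.

End MotionPolynomials.

(** * Coefficients, degrees and products of monic motion polynomials *)

Section Monic.
Variable R : realType.
Implicit Types (A B : quat {poly R}) (p q r : quat R).
Implicit Types (M X : dq {poly R}) (h : dq R) (i n : nat).

Definition qcoef i A : quat R := qmap (fun x : {poly R} => x`_i) A.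

Lemma qcoefD i A B : qcoef i (A + B) = qcoef i A + qcoef i B.
Proof. by apply: quat_ext; rewrite /= coefD. Qed.

Lemma qcoefMC i A r : qcoef i (A * qC r) = qcoef i A * r.
Proof. by apply: quat_ext; rewrite /= ?(coefB, coefD, coefMC). Qed.

Lemma qcoefCM i A r : qcoef i (qC r * A) = r * qcoef i A.
Proof. by apply: quat_ext; rewrite /= ?(coefB, coefD, coefCM). Qed.

Lemma qcoefMX i A : qcoef i.+1 (A * qreal 'X) = qcoef i A.
Proof.
by apply: quat_ext; rewrite /= !(mulr0, subr0, oppr0, addr0, add0r) coefMX.
Qed.

Lemma qcoefN i A : qcoef i (- A) = - qcoef i A.
Proof. by apply: quat_ext; rewrite /= coefN. Qed.

Lemma qcoefM_qlin i A p :
  qcoef i.+1 (A * qlin p) = qcoef i A - qcoef i.+1 A * p.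
Proof. by rewrite mulrBr qcoefD qcoefN qcoefMX qcoefMC. Qed.

Lemma qcoef_qlinM i A p :
  qcoef i.+1 (qlin p * A) = qcoef i A - p * qcoef i.+1 A.
Proof. by rewrite mulrBl qcoefD qcoefN qcoefCM qrealC qcoefMX. Qed.

Lemma qcoef_eq A B : (forall i, qcoef i A = qcoef i B) -> A = B.
Proof.
by move=> e; apply: quat_ext; apply/polyP => i; case: (e i).
Qed.

Lemma qcoef_large A i : (qsize A <= i)%N -> qcoef i A = 0.
Proof.
rewrite /qsize !geq_max => /andP[/andP[h0 h1] /andP[h2 h3]].
by apply: quat_ext; rewrite /= nth_default.
Qed.

(** Phrased by coefficients rather than [dqsize], so that the degree can be followed through
    products and quotients. *)
Definition monic_deg n M :=
  [/\ qcoef n (prim M) = 1, qcoef n (dual M) = 0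
    & forall i, (n < i)%N -> qcoef i (prim M) = 0 /\ qcoef i (dual M) = 0].

Lemma dq_monic_deg M : dq_monic M -> monic_deg (dqsize M).-1 M.
Proof.
case=> e0 e1 e2 e3 e4 e5 e6 e7; split; try exact: quat_ext.
move=> i lt_i; have : (dqsize M <= i)%N by lia.
by rewrite geq_max => /andP[hP hD]; split; apply: qcoef_large.
Qed.

Lemma monic_deg0 M : monic_deg 0 M -> M = dqone {poly R}.
Proof.
case: M => P D [/= eP eD e]; congr DQ; apply: qcoef_eq => -[|i].
- by rewrite eP; apply: quat_ext; rewrite /= ?coef0 ?coef1.
- by case: (e i.+1) => // -> _; apply: quat_ext; rewrite /= ?coef0 ?coef1.
- by rewrite eD; apply: quat_ext; rewrite /= ?coef0.
- by case: (e i.+1) => // _ ->; apply: quat_ext; rewrite /= ?coef0.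
Qed.

(** Comparing coefficients expresses coefficient i of X through coefficients i + 1 of X and of the
    product. One descends from above the size of X, where all vanish, to n. *)
Lemma monic_deg_quotient n X h :
  monic_deg n.+1 (dqmul X (lin_poly h)) -> monic_deg n X.
Proof.
rewrite lin_polyE dqmulE; case: X h => P D [p q] /= [/= eP eD e].
have stepP i : qcoef i P = qcoef i.+1 (P * qlin p) + qcoef i.+1 P * p.
  by rewrite qcoefM_qlin subrK.
have stepD i : qcoef i D = qcoef i.+1 (P * - qC q + D * qlin p)
    + qcoef i.+1 P * q + qcoef i.+1 D * p.
  by rewrite qcoefD mulrN qcoefN qcoefMC qcoefM_qlin (addrC (- _)) !subrK.
(* [k] bounds the distance from i up to the size of X. *)
have z k i : (n < i)%N -> (maxn (qsize P) (qsize D) <= i + k)%N ->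
    qcoef i P = 0 /\ qcoef i D = 0.
  elim: k i => [|k IH] i lt_i.
    by rewrite addn0 geq_max => /andP[? ?]; split; apply: qcoef_large.
  rewrite addnS -addSn => le_i.
  have [||zP zD] := IH i.+1 => //; first exact: ltnW.
  by have [//|cP cD] := e i.+1; rewrite stepP stepD zP zD cP cD !mul0r !addr0.
have [||zP zD] := z (maxn (qsize P) (qsize D)) n.+1; rewrite ?leq_addl //.
split=> [||i lt_i] /=; last exact: z lt_i (leq_addl i _).
  by rewrite stepP zP mul0r addr0 eP.
by rewrite stepD zP zD !mul0r !addr0 eD.
Qed.

Lemma monic_deg_linM n M p :
  monic_deg n M -> monic_deg n.+1 (dqmul (lin_poly (DQ p 0)) M).
Proof.
rewrite lin_polyE dqmulE qC0 oppr0; case: M => P D [/= eP eD e].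
split; rewrite /= ?mul0r ?addr0 ?qcoef_qlinM.
- by have [//|-> _] := e n.+1; rewrite ?mulr0 ?subr0.
- by have [//|_ ->] := e n.+1; rewrite ?mulr0 ?subr0.
case=> // i lt_i; rewrite !qcoef_qlinM.
have [//|-> ->] := e i; have [|-> ->] := e i.+1; first exact: leqW.
by rewrite !mulr0 !subr0.
Qed.

Lemma coef_sqr_top (q : {poly R}) n :
  (forall i, (n < i)%N -> q`_i = 0) -> (q ^+ 2)`_(n + n) = q`_n ^+ 2.
Proof.
move=> z; have ln : (n < (n + n).+1)%N by rewrite ltnS leq_addr.
rewrite expr2 coefM (bigD1 (Ordinal ln)) //= addnK.
rewrite big1 ?addr0 -?expr2 // => i ne.
have [lt|le] := ltnP n i; first by rewrite z ?mul0r.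
rewrite [X in _ * X]z ?mulr0 //.
have : (i < n)%N.
  rewrite ltn_neqAle le andbT.
  by apply: contraNneq ne => e; apply/eqP/val_inj.
lia.
Qed.

(** The norm has coefficient 1 at twice the degree, so it is not constant and [quad_factor] can
    apply to it. *)
Lemma size_nrm_monic n M : monic_deg n.+1 M -> (1 < size (nrm (prim M)))%N.
Proof.
case=> -[e0 e1 e2 e3] _ z; rewrite ltnNge; apply/negP => s.
have : (nrm (prim M))`_(n.+1 + n.+1) = 0.
  by rewrite nth_default // (leq_trans s) // addnS.
have z' i : (n.+1 < i)%N -> qcoef i (prim M) = 0 by case/z.
rewrite /nrm !coefD !coef_sqr_top; try by move=> i /z'[].
by rewrite e0 e1 e2 e3 => /eqP; rewrite !expr0n /= !addr0 expr1n oner_eq0.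
Qed.

Lemma dqmulA M X Y : dqmul M (dqmul X Y) = dqmul (dqmul M X) Y.
Proof. by rewrite !dqmulE /= !mulrA !mulrDr !mulrDl !mulrA addrA. Qed.

Lemma dqscaleMl (Q : {poly R}) M X :
  dqscale Q (dqmul M X) = dqmul (dqscale Q M) X.
Proof. by rewrite /dqscale !dqmulE !qmulE /= mulrDr !mulrA. Qed.

Lemma dqscaleMr (Q : {poly R}) M X :
  dqscale Q (dqmul M X) = dqmul M (dqscale Q X).
Proof. by rewrite /dqscale !dqmulE !qmulE /= mulrDr !mulrA -!(qrealC Q). Qed.

Lemma dqscaleM (Q S : {poly R}) M :
  dqscale (Q * S) M = dqscale Q (dqscale S M).
Proof. by rewrite /dqscale !qmulE /= qrealM !mulrA. Qed.

Lemma dqprod_rcons (hs : seq (dq R)) h :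
  dqprod (rcons hs h) = dqmul (dqprod hs) (lin_poly h).
Proof.
elim: hs => [|g hs IH] /=; last by rewrite IH dqmulA.
rewrite !dqmulE /= -[qone _]/(1 : quat {poly R}) -[qzero _]/(0 : quat {poly R}).
by rewrite !mul1r !mulr1 mulr0 mul0r add0r addr0.
Qed.

Lemma all_rotation_rcons (hs : seq (dq R)) h :
  all_rotation hs -> rotation_h h -> all_rotation (rcons hs h).
Proof. by elim: hs => //= g hs IH [rg rhs] rh; split=> //; apply: IH. Qed.

Lemma rotation_quad p a b :
  b != 0 -> nrm (qlin p) = quad a b -> rotation_h (DQ p 0).
Proof.
move=> b0 np; apply: rotationP => //; last exact: qlin_nonreal np.
by rewrite /qdot /= !mulr0 !addr0.
Qed.

(** [qdot] is half of P D^bar + D P^bar, and a sum of four real squares vanishes only if each of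
    them does. *)
Definition bounded_motion M :=
  qdot (prim M) (dual M) = 0 /\ forall x, (nrm (prim M)).[x] != 0.

Lemma qdot_rotation h :
  rotation_h h -> qdot (qlin (prim h)) (- qC (dual h)) = 0.
Proof.
case: h => p q [[e0 _ _ _]] [[e1 _ _ _] _]; move: e0 e1; rewrite /= => e0 e1.
have q00 : q0 q = 0 by lra.
have pq : qdot p q = 0 by move: e1; rewrite /qdot /=; lra.
have -> : qdot (qlin p) (- qC q) = - qdot (qlin p) (qC q).
  by rewrite /qdot /=; ring.
by rewrite qdot_qlin q00 pq polyC0 mul0r subr0 oppr0.
Qed.

(** By [qdotM] the inner product for X (t - h) is that for X times the norm of t - p, and this norm
    is a nonzero polynomial. *)
Lemma bounded_motion_quotient X h : rotation_h h ->
  bounded_motion (dqmul X (lin_poly h)) -> bounded_motion X.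
Proof.
move=> rh; rewrite lin_polyE dqmulE /bounded_motion /= qdotM nrmM.
rewrite qdot_rotation // mulr0 add0r.
move=> [e nz]; split; last first.
  by move=> x; move: (nz x); rewrite hornerM mulf_eq0 => /norP[].
move/eqP: e; rewrite mulf_eq0 => /orP[/eqP//|/eqP n0].
by move: (nz 0); rewrite n0 mulr0 horner0 eqxx.
Qed.
End Monic.

(** * The induction, and the comparison of the content with the greatest real factor *)

(** Strong induction on [k + n]. Splitting off a factor lowers n and keeps k; the swap keeps n,
    lowers k by 2 and raises the allowed degree of Q by 2. *)
Lemma rotation_factorization (R : realType) k n (M : dq {poly R}) :
  monic_deg n M -> bounded_motion M -> (size (content (prim M)) <= k.+1)%N ->
  exists (Q : {poly R}) (hs : seq (dq R)),
    (size Q <= k.+1)%N /\ all_rotation hs /\ dqscale Q M = dqprod hs.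
Proof.
have [m] := ubnP (k + n); elim: m => // m IH in k n M *; rewrite ltnS => le_m.
case: n le_m => [|n] le_m mM gM sk.
  exists 1, [::]; split; first by rewrite size_poly1.
  split=> //; rewrite (monic_deg0 mM) /dqscale /=; congr DQ; exact: mul1r.
have [a [b [b0 dN]]] := quad_factor gM.2 (size_nrm_monic mM).
have P0 : prim M != 0.
  apply/eqP=> P0; move: (gM.2 0).
  by rewrite P0 /nrm /= !expr0n /= !addr0 horner0 eqxx.
have c0 : content (prim M) != 0 by apply: contra_neq P0; apply: content_eq0.
have step h X : rotation_h h -> M = dqmul X (lin_poly h) ->
    exists (Q : {poly R}) (hs : seq (dq R)),
    (size Q <= k.+1)%N /\ all_rotation hs /\ dqscale Q M = dqprod hs.
  move=> rh eM; rewrite eM in mM gM.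
  have [||||Q [hs [sQ [rhs e]]]] := IH k n X.
  - by rewrite addnS in le_m.
  - exact: monic_deg_quotient mM.
  - exact: bounded_motion_quotient gM.
  - apply: leq_trans sk; apply: dvdp_leq => //.
    apply/real_dividesE; rewrite eM lin_polyE dqmulE /=.
    by apply: real_dividesMr; apply/real_dividesE.
  exists Q, (rcons hs h); split=> //; split; first exact: all_rotation_rcons.
  by rewrite eM dqscaleMl e dqprod_rcons.
have [dP|ndP] := boolP (quad a b %| content (prim M)); last first.
  have [|h [X [rh eM]]] := dual_right_factor b0 gM.1 dN.
    by move/real_dividesE; apply/negP.
  exact: step rh eM.
have rdP := (real_dividesE (quad a b) (prim M)).2 dP.
have [dD|ndD] := boolP (quad a b %| nrm (dual M)).
  have [p [X [np eM]]] := primal_right_factor dD rdP.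
  exact: step (rotation_quad b0 np) eM.
have [p [p' [X [np np' eX dX]]]] := swap_factor b0 P0 gM.1 rdP ndD.
(* N divides the nonzero content, so k is at least 2 and [k - 2] is not truncated. *)
have le3 : (3 <= k.+1)%N.
  by apply: leq_trans sk; rewrite -(size_quad a b); apply: dvdp_leq.
have N0 := quad_neq0 a b.
have sX : (size (content (prim X)) <= (k - 2).+1)%N.
  have X0 : content (prim X) != 0.
    by apply: contraTneq dX => ->; rewrite mul0r dvd0p.
  have := leq_trans (dvdp_leq c0 dX) sk.
  rewrite size_mul // size_quad !addnS addn0 /=; move: (size _) le3 => d; lia.
have gX : bounded_motion X.
  apply: (bounded_motion_quotient (rotation_quad b0 np')).
  rewrite -eX lin_polyE dqmulE /bounded_motion /=.
  rewrite qC0 oppr0 mul0r addr0 nrmM np; split.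
    have := qdotM (qlin p) (prim M) 0 (dual M).
    by rewrite mul0r addr0 gM.1 mulr0 add0r => ->; rewrite /qdot /=; ring.
  by move=> x; rewrite hornerM mulf_neq0 ?gM.2 // gt_eqF // quad_gt0.
have [||||Q [hs [sQ [rhs e]]]] := IH (k - 2)%N n.+1 X => //.
- lia.
- apply: (@monic_deg_quotient _ _ _ (DQ p' 0)); rewrite -eX.
  exact: monic_deg_linM.
exists (Q * quad a b), (DQ (qconj p) 0 :: rcons hs (DQ p' 0)); split.
  have [->|Q0] := eqVneq Q 0; first by rewrite mul0r size_poly0.
  rewrite size_mul // size_quad !addnS addn0 /=.
  by move: (size _) sQ le3 => d; lia.
split.
  split.
    by apply: (rotation_quad b0 (p := qconj p)); rewrite -qlin_conj nrm_conj np.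
  exact: all_rotation_rcons rhs (rotation_quad b0 np').
have eN : dqscale (quad a b) M =
    dqmul (lin_poly (DQ (qconj p) 0)) (dqmul (lin_poly (DQ p 0)) M).
  rewrite dqmulA /dqscale !lin_polyE !dqmulE /= qC0 oppr0 !mulr0 !mul0r !addr0.
  by rewrite mul0r addr0 -qlin_conj qconj_mul np.
by rewrite dqscaleM eN eX /= dqprod_rcons -e -dqscaleMl -dqscaleMr.
Qed.

Theorem theorem4 (R : realType) (M : dq {poly R}) (G : {poly R}) :
  motion_poly M -> dq_monic M -> bounded M ->
  greatest_real_factor G (prim M) ->
  exists (Q : {poly R}) (hs : seq (dq R)),
    (size Q <= size G)%N /\
    all_rotation hs /\
    dqscale Q M = dqprod hs.
Proof.
move=> [motM _] monM bndM [monG [_ maxG]].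
have mM := dq_monic_deg monM.
have gM : bounded_motion M.
  split.
    (* The real coordinate of the motion condition is twice [qdot]. *)
    case: motM => + _ _ _; rewrite /= => e; apply: (@mulfI _ 2%:R).
      by rewrite -polyC_natr polyC_eq0 pnatr_eq0.
    by rewrite mulr0 -e /qdot; ring.
  move=> x; apply/eqP => nx; apply: (bndM x).
  apply: nrm_eq0; rewrite -nx /nrm /= !hornerE; ring.
have P0 : prim M <> 0.
  move=> P0; apply: (bndM 0); rewrite P0.
  by apply: quat_ext; rewrite /= horner0.
have c0 : content (prim M) != 0 by apply/eqP => /content_eq0.
have sG : (size G).-1.+1 = size G.
  by rewrite prednK // size_poly_gt0 monic_neq0.
rewrite -sG; apply: (rotation_factorization mM gM); rewrite sG.
(* Maximality of G concerns monic factors, so the content is scaled to leading coefficient 1, which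
   keeps its size. *)
rewrite -(@size_scale _ (lead_coef (content (prim M)))^-1);
  last by rewrite invr_eq0 lead_coef_eq0.
apply: maxG; first by rewrite monicE lead_coefZ mulVf // lead_coef_eq0.
by apply/real_dividesE; rewrite dvdpZl // invr_eq0 lead_coef_eq0.
Qed.
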